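(* Let $M$ be an $E$-$E$-bimodule that is $Z$-free with $Z$-free generator $M_0$, and suppose $M$ is also $Z$-freely generated by the $Z$-$Z$-subbimodule $M_0'$ of $M$. Let $P$ be any potential of $\mathcal F_E(M)$. Let $R(P)$ be the ideal defined using $M_0$, $F$-bases $L(i)$ of $e_iE$ and $F$-bases $A(i,j)$ of the nonzero $e_iM_0e_j$, and let $R'(P)$ be the ideal defined using $M_0'$, $F$-bases $L'(i)$ of $e_iE$ and $F$-bases $A'(i,j)$ of the nonzero $e_iM_0'e_j$. Then $R'(P)=R(P)$.
   Context: $F$ is a field, $E_1,\dots,E_n$ are finite-dimensional semisimple $F$-algebras, $E=\prod_{i=1}^nE_i$, $e_i\in E$ is the image of the identity of $E_i$, and $Z=\sum_i Fe_i\subseteq E$. All bimodules $M$ considered are finite-dimensional over $F$ with $F$ acting centrally. $\mathcal{F}_E(M)=\prod_{i\ge 0}M^{\otimes i}$ (tensor powers over $E$, $M^{\otimes0}=E$), with product $(fg)(i)=\sum_{s+t=i}f(s)g(t)$ ($f(i)$ is the degree $i$ component) and the topology of the metric $d(f,g)=2^{-\nu(f-g)}$, $\nu(h)=\min\{i:h(i)\ne0\}$. $T_E(M)\subseteq\mathcal F_E(M)$ is the tensor algebra. A potential is an element $P\in\mathcal{F}_E(M)$ with $P=\sum_i e_iPe_i$. $M$ is $Z$-free, with $Z$-free generator $M_0$ (or ''$Z$-freely generated by $M_0$''), if $M_0$ is a $Z$-$Z$-subbimodule such that the multiplication map $E\otimes_ZM_0\otimes_ZE\to M$ is an isomorphism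 of $E$-$E$-bimodules. Given such $M_0$: let $T=T_E(M)$ and let $\Delta:T\to T\otimes_ZT$ be the unique $F$-derivation with $\Delta(s)=1\otimes s-s\otimes1$ for $s\in E$ and $\Delta(m)=1\otimes m$ for $m\in M_0$. Let $u:T\otimes_ZT\to T$, $u(a\otimes b)=\sum_ie_ibae_i$. Put $\mathfrak h(f)(g)=u(\Delta(f)g)$ for $f,g\in T$, extended to $f,g\in\mathcal F_E(M)$ by $\mathfrak h(f)(g)(l)=\sum_{i+j=l}\mathfrak h(f(i))(g(j))$, and $\delta(f)=\mathfrak h(f)(1)$. For $\psi\in M^*=\mathrm{Hom}_E(M_E,E_E)$, extend $\psi$ to $\mathcal F_E(M)$ by $\psi(s)=0$ for $s\in E$, $\psi(m_1\cdots m_l)=\psi(m_1)m_2\cdots m_l$, $\psi(f)=\sum_l\psi(f(l))$; put $\delta_\psi(f)=\psi(\delta(f))$. The ideal $R(P)$ defined using $M_0$, $L(i)$, $A(i,j)$: let $A=\bigcup A(i,j)$ and for $a\in A(i,j)$ write $\tau(a)=i$, $\sigma(a)=j$. For $a\in A$, $s\in L(\tau(a))$, let $(sa)^*:M_E\to E$ be the right $E$-linear map with $(sa)^*(sa)=e_{\sigma(a)}$ and $(sa)^*(s'a')=0$ for all other products $s'a'$ with $a'\in A$, $s'\in L(\tau(a'))$. Put $X_{a^*}(P)=\sum_{s\in L(\tau(a))}\delta_{(sa)^*}(P)s$. $R(P)$ is the closure of the two-sided ideal of $\mathcal F_E(M)$ generated by all $X_{a^*}(P)$, $a\in A$. $R'(P)$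 is obtained by the same recipe (including the construction of $\delta$) from $M_0'$, $L'(i)$, $A'(i,j)$. *)

(* Defs.v *)
From HB Require Import structures.
From mathcomp Require Import all_boot all_order all_algebra all_field.
From mathcomp Require Import boolp classical_sets.

Set Implicit Arguments.
Unset Strict Implicit.
Unset Printing Implicit Defensive.

Import Order.TTheory GRing.Theory Num.Theory.
Local Open Scope ring_scope.

(** The tensor product [M (x)_S N] over an [F]-algebra of scalars [S], where
  [r : M -> S -> M] and [l : S -> N -> N] are the actions of the scalars.
  An element is a formal sum of pairs [(m, n)], modulo the least [F]-linear
  congruence that makes the pairs [F]-bilinear and identifies [(m s, n)] with
  [(m, s n)].  The factor [k] in [teq_bal] makes the congruence
  stable under [F] whatever [r] and [l] are; it is redundant when they are
  [F]-linear. *)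

Section Tensor.
Variables (F : fieldType) (S : Type) (M N : lmodType F).
Variables (r : M -> S -> M) (l : S -> N -> N).

Inductive teq : seq (M * N) -> seq (M * N) -> Prop :=
| teq_refl a : teq a a
| teq_sym a b : teq a b -> teq b a
| teq_trans a b c : teq a b -> teq b c -> teq a c
| teq_cat a b a' b' : teq a a' -> teq b b' -> teq (a ++ b) (a' ++ b')
| teq_catC a b : teq (a ++ b) (b ++ a)
| teq_zero n : teq [:: (0, n)] [::]
| teq_addl m m' n : teq [:: (m + m', n)] [:: (m, n); (m', n)]
| teq_addr m n n' : teq [:: (m, n + n')] [:: (m, n); (m, n')]
| teq_scale k m n : teq [:: (k *: m, n)] [:: (m, k *: n)]
| teq_bal k m s n : teq [:: (k *: r m s, n)] [:: (k *: m, l s n)].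

Definition teqb (a b : seq (M * N)) : bool := `[< teq a b >].

Lemma teqb_refl : reflexive teqb.
Proof. by move=> a; apply/asboolP; exact: teq_refl. Qed.

Lemma teqb_sym : symmetric teqb.
Proof. by move=> a b; apply/asboolP/asboolP => h; exact: teq_sym. Qed.

Lemma teqb_trans : transitive teqb.
Proof.
move=> b a c /asboolP h1 /asboolP h2; apply/asboolP; exact: teq_trans h1 h2.
Qed.

Canonical teq_equiv := EquivRel teqb teqb_refl teqb_sym teqb_trans.

Definition tens : Type := {eq_quot teq_equiv}%qT.
HB.instance Definition _ := Choice.copy tens {eq_quot teq_equiv}%qT.

Definition tcls (a : seq (M * N)) : tens := (\pi_({eq_quot teq_equiv}) a)%qT.
Definition trepr (x : tens) : seq (M * N) := @repr _ {eq_quot teq_equiv}%qT x.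

Lemma tclsP a b : tcls a = tcls b <-> teq a b.
Proof.
split; rewrite /tcls; first by move=> /eqquotP /asboolP.
by move=> h; apply/eqquotP/asboolP.
Qed.

Lemma treprK : cancel trepr tcls.
Proof. exact: reprK. Qed.

Lemma teq_repr a : teq (trepr (tcls a)) a.
Proof. by apply/tclsP; rewrite treprK. Qed.

Definition tscl (k : F) (a : seq (M * N)) := [seq (k *: p.1, p.2) | p <- a].

Lemma teq_tscl k a b : teq a b -> teq (tscl k a) (tscl k b).
Proof.
elim => {a b} /=.
- by move=> a; exact: teq_refl.
- by move=> a b _; exact: teq_sym.
- by move=> a b c _ h1 _; exact: teq_trans h1.
- by move=> a b a' b' _ h1 _ h2; rewrite /tscl !map_cat; exact: teq_cat.
- by move=> a b; rewrite /tscl !map_cat; exact: teq_catC.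
- by move=> n; rewrite scaler0; exact: teq_zero.
- by move=> m m' n; rewrite scalerDr; exact: teq_addl.
- by move=> m n n'; exact: teq_addr.
- move=> c m n; rewrite scalerA mulrC -scalerA; exact: teq_scale.
- by move=> c m s n; rewrite !scalerA; exact: teq_bal.
Qed.

Definition tzero : tens := tcls [::].
Definition tadd (x y : tens) : tens := tcls (trepr x ++ trepr y).
Definition topp (x : tens) : tens := tcls (tscl (-1) (trepr x)).
Definition tscale (k : F) (x : tens) : tens := tcls (tscl k (trepr x)).

Lemma tadd_cls a b : tadd (tcls a) (tcls b) = tcls (a ++ b).
Proof. by apply/tclsP; apply: teq_cat; exact: teq_repr. Qed.

Lemma tscale_cls k a : tscale k (tcls a) = tcls (tscl k a).
Proof. by apply/tclsP; apply: teq_tscl; exact: teq_repr. Qed.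

Lemma taddA : associative tadd.
Proof.
move=> x y z; rewrite -(treprK x) -(treprK y) -(treprK z).
by rewrite !tadd_cls catA.
Qed.

Lemma taddC : commutative tadd.
Proof.
move=> x y; rewrite -(treprK x) -(treprK y) !tadd_cls.
by apply/tclsP; exact: teq_catC.
Qed.

Lemma tadd0 : left_id tzero tadd.
Proof. by move=> x; rewrite -(treprK x) tadd_cls. Qed.

Lemma taddN : left_inverse tzero topp tadd.
Proof.
move=> x; rewrite -(treprK x) [topp _]tscale_cls tadd_cls; apply/tclsP.
elim: (trepr x) => [|[m n] a IH] /=; first exact: teq_refl.
have h : teq [:: (-1 *: m, n); (m, n)] [::].
  apply: teq_trans (teq_zero n); rewrite scaleN1r -(addNr m).
  exact: teq_sym (teq_addl _ _ _).
rewrite -cat1s -[(m, n) :: a]cat1s.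
apply: (teq_trans (b := [:: (-1 *: m, n)] ++ ([:: (m, n)] ++ (tscl (-1) a ++ a)))).
  apply: teq_cat; first exact: teq_refl.
  rewrite !catA; apply: teq_cat; last exact: teq_refl.
  exact: teq_catC.
rewrite catA -[X in teq _ X]cats0; exact: teq_cat.
Qed.

HB.instance Definition _ := GRing.isZmodule.Build tens taddA taddC tadd0 taddN.

Lemma tclsD a b : tcls a + tcls b = tcls (a ++ b).
Proof. exact: tadd_cls. Qed.

Lemma tscaleA j k x : tscale j (tscale k x) = tscale (j * k) x.
Proof.
rewrite -(treprK x) !tscale_cls /tscl -map_comp; congr tcls.
by apply: eq_map => p /=; rewrite scalerA.
Qed.

Lemma tscale1 : left_id 1 tscale.
Proof.
move=> x; rewrite -(treprK x) tscale_cls /tscl; congr tcls.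
by rewrite -[RHS]map_id; apply: eq_map => -[m n] /=; rewrite scale1r.
Qed.

Lemma tscaleDr : right_distributive tscale +%R.
Proof.
move=> k x y; rewrite -(treprK x) -(treprK y).
by rewrite tclsD !tscale_cls tclsD /tscl map_cat.
Qed.

Lemma tscaleDl x : {morph tscale^~ x : j k / j + k}.
Proof.
move=> j k /=; rewrite -(treprK x) !tscale_cls tclsD; apply/tclsP.
elim: (trepr x) => [|[m n] a IH] /=; first exact: teq_refl.
rewrite -cat1s -[_ :: _ ++ _]cat1s -[_ :: tscl k a]cat1s.
apply: (teq_trans (b := [:: (j *: m, n)] ++ ([:: (k *: m, n)] ++ (tscl j a ++ tscl k a)))).
  rewrite catA; apply: teq_cat => //; rewrite scalerDl; exact: teq_addl.
apply: teq_cat; first exact: teq_refl.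
rewrite !catA; apply: teq_cat; last exact: teq_refl.
exact: teq_catC.
Qed.

HB.instance Definition _ := GRing.Zmodule_isLmodule.Build F tens
  tscaleA tscale1 tscaleDr tscaleDl.

Definition tpure (m : M) (n : N) : tens := tcls [:: (m, n)].

Lemma tclsE a : tcls a = \sum_(p <- a) tpure p.1 p.2.
Proof.
elim: a => [|[m n] a IH]; first by rewrite big_nil.
by rewrite big_cons -IH tclsD.
Qed.

Lemma tens_ind (P : tens -> Prop) :
  P 0 -> (forall m n, P (tpure m n)) ->
  (forall x y, P x -> P y -> P (x + y)) -> forall x, P x.
Proof.
move=> h0 h1 h2 x; rewrite -(treprK x) tclsE.
by elim/big_ind: _ => // i _; exact: h1.
Qed.

Lemma tpureDl m m' n : tpure (m + m') n = tpure m n + tpure m' n.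
Proof. by rewrite tclsD; apply/tclsP; exact: teq_addl. Qed.

Lemma tpureDr m n n' : tpure m (n + n') = tpure m n + tpure m n'.
Proof. by rewrite tclsD; apply/tclsP; exact: teq_addr. Qed.

Lemma tpureZl k m n : tpure (k *: m) n = k *: tpure m n.
Proof. by rewrite [RHS]tscale_cls. Qed.

Lemma tpureZr k m n : tpure m (k *: n) = k *: tpure m n.
Proof. by rewrite -tpureZl; apply/tclsP; exact: teq_sym (teq_scale _ _ _). Qed.

Lemma tpure_bal m s n : tpure (r m s) n = tpure m (l s n).
Proof.
by apply/tclsP; have := teq_bal 1 m s n; rewrite !scale1r.
Qed.

Lemma tpure0l n : tpure 0 n = 0.
Proof. by rewrite -(scale0r 0) tpureZl scale0r. Qed.

Lemma tpure0r m : tpure m 0 = 0.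
Proof. by rewrite -(scale0r 0) tpureZr scale0r. Qed.

Lemma tpure_sumr m (I : Type) (s : seq I) (P : pred I) (G : I -> N) :
  tpure m (\sum_(i <- s | P i) G i) = \sum_(i <- s | P i) tpure m (G i).
Proof. exact: (big_morph _ (tpureDr m) (tpure0r m)). Qed.

(** The map [M (x)_S N -> V] induced by [f : M -> N -> V].  It is computed on a
  representative, so that it is defined for every [f]; [tlift_pure] shows that
  it is the right map when [f] is balanced. *)

Definition tlift (V : zmodType) (f : M -> N -> V) (x : tens) : V :=
  \sum_(p <- trepr x) f p.1 p.2.

Record balanced (V : zmodType) (f : M -> N -> V) : Prop := Balanced {
  bal_addl : forall m m' n, f (m + m') n = f m n + f m' n;
  bal_addr : forall m n n', f m (n + n') = f m n + f m n';
  bal_scale : forall k m n, f (k *: m) n = f m (k *: n);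
  bal_bal : forall k m s n, f (k *: r m s) n = f (k *: m) (l s n) }.

Section Lift.
Variables (V : zmodType) (f : M -> N -> V).
Hypothesis fP : balanced f.

Lemma teq_lift a b : teq a b ->
  \sum_(p <- a) f p.1 p.2 = \sum_(p <- b) f p.1 p.2.
Proof.
have f0 n : f 0 n = 0.
  by apply: (@addIr _ (f 0 n)); rewrite -(bal_addl fP) !add0r.
elim => {a b} //=.
- by move=> a b c _ -> _ ->.
- by move=> a b a' b' _ h1 _ h2; rewrite !big_cat /= h1 h2.
- by move=> a b; rewrite !big_cat /= addrC.
- by move=> n; rewrite big_seq1 big_nil f0.
- by move=> m m' n; rewrite big_seq1 big_cons big_seq1 (bal_addl fP).
- by move=> m n n'; rewrite big_seq1 big_cons big_seq1 (bal_addr fP).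
- by move=> k m n; rewrite !big_seq1 (bal_scale fP).
- by move=> k m s n; rewrite !big_seq1 (bal_bal fP).
Qed.

Lemma tlift_cls a : tlift f (tcls a) = \sum_(p <- a) f p.1 p.2.
Proof. by apply: teq_lift; exact: teq_repr. Qed.

Lemma tlift_pure m n : tlift f (tpure m n) = f m n.
Proof. by rewrite tlift_cls big_seq1. Qed.

Lemma tliftD x y : tlift f (x + y) = tlift f x + tlift f y.
Proof.
rewrite -(treprK x) -(treprK y) tclsD !tlift_cls.
by rewrite big_cat.
Qed.

Lemma tlift0 : tlift f 0 = 0.
Proof. by rewrite [0]/(tcls [::]) tlift_cls big_nil. Qed.

End Lift.
End Tensor.

Definition prodalg (F : fieldType) (n : nat) (E_ : 'I_n -> falgType F) : Type :=
  {dffun forall i, E_ i}.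

Section ProdAlg.
Variables (F : fieldType) (n : nat) (E_ : 'I_n -> falgType F).
Local Notation E := (prodalg E_).

HB.instance Definition _ := Choice.copy E {dffun forall i, E_ i}.

Definition pa_fun (f : forall i, E_ i) : E := [ffun i => f i].
Definition pa_val (x : E) : forall i, E_ i :=
  let f : {dffun forall i, E_ i} := x in f.

Lemma pa_valE f i : pa_val (pa_fun f) i = f i.
Proof. by rewrite /pa_val /pa_fun ffunE. Qed.

Lemma pa_eqP (x y : E) : (forall i, pa_val x i = pa_val y i) -> x = y.
Proof. by move=> h; apply/ffunP. Qed.

Definition pa_zero : E := pa_fun (fun=> 0).
Definition pa_one : E := pa_fun (fun=> 1).
Definition pa_add (x y : E) : E := pa_fun (fun i => pa_val x i + pa_val y i).
Definition pa_opp (x : E) : E := pa_fun (fun i => - pa_val x i).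
Definition pa_mul (x y : E) : E := pa_fun (fun i => pa_val x i * pa_val y i).
Definition pa_scale (k : F) (x : E) : E := pa_fun (fun i => k *: pa_val x i).

Local Ltac pa := apply: pa_eqP => i; rewrite !pa_valE.

Lemma pa_addA : associative pa_add.
Proof. by move=> x y z; pa; exact: addrA. Qed.
Lemma pa_addC : commutative pa_add.
Proof. by move=> x y; pa; exact: addrC. Qed.
Lemma pa_add0 : left_id pa_zero pa_add.
Proof. by move=> x; pa; exact: add0r. Qed.
Lemma pa_addN : left_inverse pa_zero pa_opp pa_add.
Proof. by move=> x; pa; exact: addNr. Qed.
HB.instance Definition _ := GRing.isZmodule.Build E
  pa_addA pa_addC pa_add0 pa_addN.

Lemma pa_mulA : associative pa_mul.
Proof. by move=> x y z; pa; exact: mulrA. Qed.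
Lemma pa_mul1 : left_id pa_one pa_mul.
Proof. by move=> x; pa; exact: mul1r. Qed.
Lemma pa_mulr1 : right_id pa_one pa_mul.
Proof. by move=> x; pa; exact: mulr1. Qed.
Lemma pa_mulDl : left_distributive pa_mul +%R.
Proof. by move=> x y z; pa; exact: mulrDl. Qed.
Lemma pa_mulDr : right_distributive pa_mul +%R.
Proof. by move=> x y z; pa; exact: mulrDr. Qed.
HB.instance Definition _ := GRing.Zmodule_isPzRing.Build E
  pa_mulA pa_mul1 pa_mulr1 pa_mulDl pa_mulDr.

Lemma pa_scaleA j k x : pa_scale j (pa_scale k x) = pa_scale (j * k) x.
Proof. by pa; exact: scalerA. Qed.
Lemma pa_scale1 : left_id 1 pa_scale.
Proof. by move=> x; pa; exact: scale1r. Qed.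
Lemma pa_scaleDr : right_distributive pa_scale +%R.
Proof. by move=> k x y; pa; exact: scalerDr. Qed.
Lemma pa_scaleDl x : {morph pa_scale^~ x : j k / j + k}.
Proof. by move=> j k; pa; exact: scalerDl. Qed.
HB.instance Definition _ := GRing.Zmodule_isLmodule.Build F E
  pa_scaleA pa_scale1 pa_scaleDr pa_scaleDl.

Lemma pa_addE (x y : E) i : pa_val (x + y) i = pa_val x i + pa_val y i.
Proof. exact: pa_valE. Qed.
Lemma pa_mulE (x y : E) i : pa_val (x * y) i = pa_val x i * pa_val y i.
Proof. exact: pa_valE. Qed.
Lemma pa_scaleE k (x : E) i : pa_val (k *: x) i = k *: pa_val x i.
Proof. exact: pa_valE. Qed.

Lemma pa_scaleAl k (x y : E) : k *: (x * y) = (k *: x) * y.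
Proof.
by apply: pa_eqP => i; rewrite pa_scaleE !pa_mulE pa_scaleE scalerAl.
Qed.

Lemma pa_scaleAr k (x y : E) : k *: (x * y) = x * (k *: y).
Proof.
by apply: pa_eqP => i; rewrite pa_scaleE !pa_mulE pa_scaleE scalerAr.
Qed.

Import VectorInternalTheory.
Lemma pa_findim : Vector.axiom (\sum_(i < n) dim (E_ i))%N E.
Proof.
pose p i := dim (E_ i).
exists (fun x : E => \mxrow_i (v2r (pa_val x i) : 'rV_(p i))).
  move=> k x y; apply/matrixP => a b; rewrite !mxE /=.
  by rewrite pa_addE pa_scaleE linearP !mxE.
pose g (v : 'rV_(\sum_i p i)) i : E_ i := @r2v _ (E_ i) (submxrow v i).
exists (fun v => pa_fun (g v)).
  by move=> x; apply: pa_eqP => i; rewrite pa_valE /g mxrowK v2rK.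
by move=> v; apply/mxrowP => i; rewrite mxrowK pa_valE /g r2vK.
Qed.
HB.instance Definition _ := Lmodule_hasFinDim.Build F E pa_findim.

End ProdAlg.

(** The last axiom of [lmodule] says that the action of [F] through [E] is the
  ambient one; those of [bimodule] say that it is so on both sides, i.e., that
  [F] acts centrally. *)

Record lmodule (F : fieldType) (n : nat) (E_ : 'I_n -> falgType F) := LModule {
  lm_sort :> lmodType F;
  lm_act : prodalg E_ -> lm_sort -> lm_sort;
  lm_actDl : forall a b x, lm_act (a + b) x = lm_act a x + lm_act b x;
  lm_actDr : forall a x y, lm_act a (x + y) = lm_act a x + lm_act a y;
  lm_act1 : forall x, lm_act 1 x = x;
  lm_actM : forall a b x, lm_act (a * b) x = lm_act a (lm_act b x);
  lm_actF : forall k x, lm_act (k *: (1 : prodalg E_)) x = k *: x }.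

Record bimodule (F : fieldType) (n : nat) (E_ : 'I_n -> falgType F) := Bimodule {
  bm_sort :> vectType F;
  lact : prodalg E_ -> bm_sort -> bm_sort;
  ract : bm_sort -> prodalg E_ -> bm_sort;
  lactDl : forall a b m, lact (a + b) m = lact a m + lact b m;
  lactDr : forall a m m', lact a (m + m') = lact a m + lact a m';
  lact1 : forall m, lact 1 m = m;
  lactM : forall a b m, lact (a * b) m = lact a (lact b m);
  ractDl : forall m m' a, ract (m + m') a = ract m a + ract m' a;
  ractDr : forall m a b, ract m (a + b) = ract m a + ract m b;
  ract1 : forall m, ract m 1 = m;
  ractM : forall m a b, ract m (a * b) = ract (ract m a) b;
  lractA : forall a m b, ract (lact a m) b = lact a (ract m b);
  lactF : forall k m, lact (k *: (1 : prodalg E_)) m = k *: m;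
  ractF : forall k m, ract m (k *: (1 : prodalg E_)) = k *: m }.

Section Modules.
Variables (F : fieldType) (n : nat) (E_ : 'I_n -> falgType F).
Local Notation E := (prodalg E_).
Variable M : bimodule E_.

Lemma lm_actZ (X : lmodule E_) a k (x : X) :
  lm_act a (k *: x) = k *: lm_act a x.
Proof.
by rewrite -!lm_actF -!lm_actM -pa_scaleAl -pa_scaleAr mul1r mulr1.
Qed.

Lemma lm_act0 (X : lmodule E_) a : lm_act a (0 : X) = 0.
Proof. by rewrite -(scale0r 0) lm_actZ !scale0r. Qed.

Lemma lm_0act (X : lmodule E_) (x : X) : lm_act 0 x = 0.
Proof. by rewrite -(scale0r (1 : E)) lm_actF scale0r. Qed.

Lemma lm_act_sum (X : lmodule E_) a (I : Type) (s : seq I) (P : pred I)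
    (G : I -> X) :
  lm_act a (\sum_(i <- s | P i) G i) = \sum_(i <- s | P i) lm_act a (G i).
Proof. exact: (big_morph _ (lm_actDr a) (lm_act0 X a)). Qed.

Lemma lactZ a k (m : M) : lact a (k *: m) = k *: lact a m.
Proof. by rewrite -!lactF -!lactM -pa_scaleAl -pa_scaleAr mul1r mulr1. Qed.

Lemma ractZ k (m : M) a : ract (k *: m) a = k *: ract m a.
Proof. by rewrite -!lactF lractA. Qed.

Definition reg_lmodule : lmodule E_.
Proof.
refine (@LModule _ _ _ E (fun a x : E => a * x) _ _ _ _ _).
- exact: mulrDl.
- exact: mulrDr.
- exact: mul1r.
- by move=> a b x; rewrite mulrA.
- by move=> k x; rewrite -pa_scaleAl mul1r.
Defined.

Section TensE.
Variable X : lmodule E_.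

Definition tensE := tens (@ract _ _ _ M) (@lm_act _ _ _ X).

Definition tensE_act (a : E) (x : tensE) : tensE :=
  tlift (fun m y => tpure _ _ (lact a m) y) x.

Lemma tensE_act_bal a : balanced (@ract _ _ _ M) (@lm_act _ _ _ X)
  (fun m y => tpure (@ract _ _ _ M) (@lm_act _ _ _ X) (lact a m) y).
Proof.
split.
- by move=> m m' y; rewrite lactDr tpureDl.
- by move=> m y y'; rewrite tpureDr.
- by move=> k m y; rewrite lactZ tpureZl tpureZr.
- by move=> k m s y; rewrite !lactZ !tpureZl -lractA tpure_bal.
Qed.

Lemma tensE_act_pure a m y :
  tensE_act a (tpure _ _ m y) = tpure _ _ (lact a m) y.
Proof. exact: tlift_pure (tensE_act_bal a) m y. Qed.

Lemma tensE_actDr a x y :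
  tensE_act a (x + y) = tensE_act a x + tensE_act a y.
Proof. exact: tliftD (tensE_act_bal a) x y. Qed.

Lemma tensE_act0 a : tensE_act a 0 = 0.
Proof. exact: tlift0 (tensE_act_bal a). Qed.

Lemma tensE_actDl a b x : tensE_act (a + b) x = tensE_act a x + tensE_act b x.
Proof.
elim/tens_ind: x => [|m y|x y hx hy].
- by rewrite !tensE_act0 addr0.
- by rewrite !tensE_act_pure lactDl tpureDl.
- by rewrite !tensE_actDr hx hy addrACA.
Qed.

Lemma tensE_act1 x : tensE_act 1 x = x.
Proof.
elim/tens_ind: x => [|m y|x y hx hy].
- by rewrite tensE_act0.
- by rewrite tensE_act_pure lact1.
- by rewrite tensE_actDr hx hy.
Qed.

Lemma tensE_actM a b x : tensE_act (a * b) x = tensE_act a (tensE_act b x).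
Proof.
elim/tens_ind: x => [|m y|x y hx hy].
- by rewrite !tensE_act0.
- by rewrite !tensE_act_pure lactM.
- by rewrite !tensE_actDr hx hy.
Qed.

Lemma tensE_actF k x : tensE_act (k *: (1 : E)) x = k *: x.
Proof.
elim/tens_ind: x => [|m y|x y hx hy].
- by rewrite tensE_act0 scaler0.
- by rewrite tensE_act_pure lactF tpureZl.
- by rewrite tensE_actDr hx hy scalerDr.
Qed.

Definition tensE_lmodule : lmodule E_ :=
  @LModule _ _ _ tensE tensE_act
    tensE_actDl tensE_actDr tensE_act1 tensE_actM tensE_actF.

End TensE.

(** [M^{(x) i}]; the isomorphism [M (x)_E E = M] is used to represent
  [M^{(x) 1}], so that [m] stands there as [m (x) 1]. *)

Fixpoint tpow (i : nat) : lmodule E_ :=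
  if i is j.+1 then tensE_lmodule (tpow j) else reg_lmodule.

Definition tcons i (m : M) (y : tpow i) : tpow i.+1 :=
  tpure (@ract _ _ _ M) (@lm_act _ _ _ (tpow i)) m y.

Definition series : Type := forall i, tpow i.

HB.instance Definition _ := gen_eqMixin series.
HB.instance Definition _ := gen_choiceMixin series.

Lemma seriesP (f g : series) : (forall i, f i = g i) -> f = g.
Proof. by move=> h; apply: functional_extensionality_dep. Qed.

Definition s_zero : series := fun i => 0.
Definition s_add (f g : series) : series := fun i => f i + g i.
Definition s_opp (f : series) : series := fun i => - f i.
Definition s_scale (k : F) (f : series) : series := fun i => k *: f i.

Lemma s_addA : associative s_add.
Proof. by move=> f g h; apply: seriesP => i; exact: addrA. Qed.
Lemma s_addC : commutative s_add.
Proof. by move=> f g; apply: seriesP => i; exact: addrC. Qed.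
Lemma s_add0 : left_id s_zero s_add.
Proof. by move=> f; apply: seriesP => i; exact: add0r. Qed.
Lemma s_addN : left_inverse s_zero s_opp s_add.
Proof. by move=> f; apply: seriesP => i; exact: addNr. Qed.
HB.instance Definition _ := GRing.isZmodule.Build series
  s_addA s_addC s_add0 s_addN.

Lemma s_scaleA j k f : s_scale j (s_scale k f) = s_scale (j * k) f.
Proof. by apply: seriesP => i; exact: scalerA. Qed.
Lemma s_scale1 : left_id 1 s_scale.
Proof. by move=> f; apply: seriesP => i; exact: scale1r. Qed.
Lemma s_scaleDr : right_distributive s_scale +%R.
Proof. by move=> k f g; apply: seriesP => i; exact: scalerDr. Qed.
Lemma s_scaleDl f : {morph s_scale^~ f : j k / j + k}.
Proof. by move=> j k; apply: seriesP => i; exact: scalerDl. Qed.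
HB.instance Definition _ := GRing.Zmodule_isLmodule.Build F series
  s_scaleA s_scale1 s_scaleDr s_scaleDl.

Lemma s_addE (f g : series) i : (f + g) i = f i + g i. Proof. by []. Qed.
Lemma s_zeroE i : (0 : series) i = 0. Proof. by []. Qed.
Lemma s_sumE (I : Type) (s : seq I) (P : pred I) (G : I -> series) i :
  (\sum_(j <- s | P j) G j) i = \sum_(j <- s | P j) G j i.
Proof. exact: (big_morph (fun f : series => f i)). Qed.

(** [lmul s x g] is the product of [x] in [M^{(x) s}] with [g]: the degree [d]
  component of [a g], for [a] in [E], is [a g(d)], and that of [(m (x) y) g] is
  [m (x) (y g)(d - 1)]. *)

Fixpoint lmul (s : nat) : tpow s -> series -> series :=
  match s return tpow s -> series -> series with
  | 0 => fun a g d => lm_act (a : E) (g d)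
  | s'.+1 => fun x g d =>
      match d return tpow d with
      | 0 => 0
      | d'.+1 => tlift (fun m (y : tpow s') => tcons m (lmul y g d')) x
      end
  end.


Lemma lmul_spec s :
  (forall (x y : tpow s) g d, lmul (x + y) g d = lmul x g d + lmul y g d) /\
  (forall a (x : tpow s) g d, lmul (lm_act a x) g d = lm_act a (lmul x g d)).
Proof.
elim: s => [|s [IHD IHa]].
  split => [x y g d|a x g d] /=; first exact: lm_actDl.
  exact: lm_actM.
have bal g m : balanced (@ract _ _ _ M) (@lm_act _ _ _ (tpow s))
    (fun m0 (y : tpow s) => tcons m0 (lmul y g m)).
  split.
  - by move=> m0 m' y; exact: tpureDl.
  - by move=> m0 y y'; rewrite IHD; exact: tpureDr.
  - by move=> k m0 y; rewrite -lm_actF IHa lm_actF /tcons tpureZl tpureZr.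
  - by move=> k m0 a y; rewrite IHa /tcons !tpureZl tpure_bal.
have D (x y : tpow s.+1) g m : lmul (x + y) g m = lmul x g m + lmul y g m.
  case: m => [|m] /=; first by rewrite addr0.
  exact: tliftD (bal g m) x y.
split => // a x g [|m]; first by rewrite /= mulr0.
elim/tens_ind: x => [|m0 y|x y hx hy].
- by rewrite lm_act0 /= (tlift0 (bal g m)) tensE_act0.
- rewrite /= tensE_act_pure !(tlift_pure (bal g m)).
  by rewrite /tcons tensE_act_pure.
- by rewrite lm_actDr !D lm_actDr hx hy.
Qed.

Lemma lmulDl s (x y : tpow s) g d : lmul (x + y) g d = lmul x g d + lmul y g d.
Proof. by have [h _] := lmul_spec s; exact: h. Qed.

Lemma lmul_act s a (x : tpow s) g d :
  lmul (lm_act a x) g d = lm_act a (lmul x g d).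
Proof. by have [_ h] := lmul_spec s; exact: h. Qed.

Lemma lmulZl s k (x : tpow s) g d : lmul (k *: x) g d = k *: lmul x g d.
Proof. by rewrite -!lm_actF lmul_act. Qed.

Lemma lmul0l s g d : lmul (0 : tpow s) g d = 0.
Proof. by rewrite -(scale0r 0) lmulZl !scale0r. Qed.

Lemma lmul_suml s g d (I : Type) (r : seq I) (P : pred I) (G : I -> tpow s) :
  lmul (\sum_(i <- r | P i) G i) g d = \sum_(i <- r | P i) lmul (G i) g d.
Proof.
apply: (big_morph (fun x : tpow s => lmul x g d)); last exact: lmul0l.
by move=> x y; exact: lmulDl.
Qed.

Lemma lmul_cons s m (y : tpow s) g d :
  lmul (tcons m y) g d.+1 = tcons m (lmul y g d).
Proof.
rewrite /= tlift_pure //; split.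
- by move=> m0 m' z; exact: tpureDl.
- by move=> m0 z z'; rewrite lmulDl; exact: tpureDr.
- by move=> k m0 z; rewrite lmulZl /tcons tpureZl tpureZr.
- by move=> k m0 a z; rewrite lmul_act /tcons !tpureZl tpure_bal.
Qed.

Lemma tpow_ind (P : forall s, tpow s -> Prop) :
  (forall a : E, P 0%N a) ->
  (forall s, P s 0) ->
  (forall s x y, P s x -> P s y -> P s (x + y)) ->
  (forall s m y, P s y -> P s.+1 (tcons m y)) ->
  forall s x, P s x.
Proof.
move=> h0 hz hD hS; elim => [|s IH] x; first exact: h0.
elim/tens_ind: x => [|m y|x y hx hy]; first exact: hz.
- by apply: hS; exact: IH.
- exact: hD.
Qed.

Lemma lmulDr s (x : tpow s) g h d : lmul x (g + h) d = lmul x g d + lmul x h d.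
Proof.
move: x d; elim/tpow_ind => {s}.
- by move=> a d; exact: lm_actDr.
- by move=> s d; rewrite !lmul0l addr0.
- by move=> s x y hx hy d; rewrite !lmulDl hx hy addrACA.
- move=> s m y hy [|d]; first by rewrite /= addr0.
  by rewrite !lmul_cons hy; exact: tpureDr.
Qed.

Lemma lmul_lt s (x : tpow s) g d : (d < s)%N -> lmul x g d = 0.
Proof.
move: x d; elim/tpow_ind => {s} //.
- by move=> s d _; rewrite lmul0l.
- by move=> s x y hx hy d h; rewrite lmulDl hx // hy // addr0.
- by move=> s m y hy [|d] // h; rewrite lmul_cons hy //; exact: tpure0r.
Qed.

Lemma lmul_large s (x : tpow s) g N d :
  (forall j, (N <= j)%N -> g j = 0) -> (s + N <= d)%N -> lmul x g d = 0.
Proof.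
move=> hg; move: x d; elim/tpow_ind => {s}.
- by move=> a d h /=; rewrite hg // lm_act0.
- by move=> s d _; rewrite lmul0l.
- by move=> s x y hx hy d h; rewrite lmulDl hx // hy // addr0.
- by move=> s m y hy [|d] // h; rewrite lmul_cons hy //; exact: tpure0r.
Qed.

Definition s_mul (f g : series) : series :=
  fun d => \sum_(s < d.+1) lmul (f s) g d.

Definition s_one : series :=
  fun d => match d return tpow d with 0 => (1 : E) | _.+1 => 0 end.

Lemma lmul_mul s (x : tpow s) g h d :
  lmul x (s_mul g h) d = s_mul (lmul x g) h d.
Proof.
move: x d; elim/tpow_ind => {s}.
- move=> a d; rewrite /= lm_act_sum; apply: eq_bigr => t _.
  by rewrite lmul_act.
- move=> s d; rewrite lmul0l /s_mul big1 // => t _.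
  by rewrite lmul0l lmul0l.
- move=> s x y hx hy d; rewrite lmulDl hx hy /s_mul -big_split /=.
  by apply: eq_bigr => t _; rewrite lmulDl lmulDl.
- move=> s m y hy [|d].
    by rewrite /s_mul big_ord1 /= mul0r.
  rewrite lmul_cons hy /s_mul [RHS]big_ord_recl -[LHS]add0r; congr (_ + _).
    by symmetry; exact: (@lm_0act (tpow d.+1)).
  rewrite [LHS]tpure_sumr; apply: eq_bigr => t _.
  by rewrite lmul_cons lmul_cons.
Qed.

Lemma s_mulA : associative s_mul.
Proof.
move=> f g h; apply: seriesP => d.
transitivity (\sum_(s < d.+1) \sum_(t < d.+1) lmul (lmul (f s) g t) h d).
  by apply: eq_bigr => s _; rewrite lmul_mul.
rewrite exchange_big /=; apply: eq_bigr => t _.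
rewrite -lmul_suml; congr (lmul _ h d).
rewrite /s_mul -(big_mkord xpredT (fun s => lmul (f s) g t)).
rewrite -(big_mkord xpredT (fun s => lmul (f s) g t)).
rewrite (big_cat_nat (n := t.+1)) //= -[RHS]addr0.
congr (_ + _); rewrite big_nat_cond big1 //.
by move=> s /andP [/andP [h1 _] _]; rewrite lmul_lt.
Qed.

Lemma lmul_one s (x : tpow s) : lmul x s_one s = x.
Proof.
elim/tpow_ind: s / x => /=.
- by move=> a; rewrite mulr1.
- by move=> s; rewrite lmul0l.
- by move=> s x y hx hy; rewrite lmulDl hx hy.
- by move=> s m y hy; rewrite [LHS]lmul_cons hy.
Qed.

Lemma lmul_one_gt s (x : tpow s) d : (s < d)%N -> lmul x s_one d = 0.
Proof. by move=> h; apply: (@lmul_large s x s_one 1%N) => [[]|] //; rewrite addn1. Qed.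

Lemma s_mul1 : left_id s_one s_mul.
Proof.
move=> f; apply: seriesP => d; rewrite /s_mul big_ord_recl big1.
  by rewrite addr0 /= lm_act1.
by move=> s _; exact: lmul0l.
Qed.

Lemma s_mulr1 : right_id s_one s_mul.
Proof.
move=> f; apply: seriesP => d; rewrite /s_mul big_ord_recr big1 /=.
  by rewrite add0r lmul_one.
by move=> s _; rewrite lmul_one_gt.
Qed.

Lemma s_mulDl : left_distributive s_mul +%R.
Proof.
move=> f g h; apply: seriesP => d; rewrite /s_mul s_addE -big_split /=.
by apply: eq_bigr => s _; rewrite s_addE lmulDl.
Qed.

Lemma s_mulDr : right_distributive s_mul +%R.
Proof.
move=> f g h; apply: seriesP => d; rewrite /s_mul s_addE -big_split /=.
by apply: eq_bigr => s _; rewrite lmulDr.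
Qed.

HB.instance Definition _ := GRing.Zmodule_isPzRing.Build series
  s_mulA s_mul1 s_mulr1 s_mulDl s_mulDr.

Lemma s_mulE (f g : series) i : (f * g) i = \sum_(s < i.+1) lmul (f s) g i.
Proof. by []. Qed.

Definition homs (i : nat) (x : tpow i) : series := fun j =>
  match i =P j with
  | ReflectT e => ecast j (tpow j) e x
  | ReflectF _ => 0
  end.

Lemma homsE i (x : tpow i) : homs x i = x.
Proof. by rewrite /homs; case: eqP => // e; rewrite eq_axiomK. Qed.

Lemma homsN i j (x : tpow i) : i != j -> homs x j = 0.
Proof. by rewrite /homs; case: eqP. Qed.

(** [T_E(M)] is the subalgebra of [F_E(M)] of the series of finite support. *)

Definition finsupp : {pred series} :=
  fun f => `[< exists N, forall i, (N <= i)%N -> f i = 0 >].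

Lemma finsuppP (f : series) :
  reflect (exists N, forall i, (N <= i)%N -> f i = 0) (f \in finsupp).
Proof. exact: asboolP. Qed.

Lemma finsupp_subring : subring_closed finsupp.
Proof.
split.
- by apply/finsuppP; exists 1%N; case.
- move=> f g /finsuppP [N hN] /finsuppP [K hK]; apply/finsuppP.
  exists (maxn N K) => i; rewrite geq_max => /andP [h1 h2].
  by rewrite s_addE hN // add0r [LHS](congr1 -%R (hK i h2)) oppr0.
- move=> f g /finsuppP [N hN] /finsuppP [K hK]; apply/finsuppP.
  exists (N + K)%N => i hi; rewrite s_mulE big1 // => s _.
  case: (leqP N s) => hs; first by rewrite hN // lmul0l.
  apply: (@lmul_large s _ g K) => //; apply: leq_trans hi.
  by rewrite leq_add2r ltnW.
Qed.

HB.instance Definition _ := GRing.isSubringClosed.Build series finsupp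
  finsupp_subring.

Lemma finsupp_scaler : scaler_closed finsupp.
Proof.
move=> k f /finsuppP [N hN]; apply/finsuppP; exists N => i hi.
by rewrite [LHS](congr1 (fun x => k *: x) (hN i hi)) scaler0.
Qed.

HB.instance Definition _ := GRing.isScaleClosed.Build F series finsupp
  finsupp_scaler.

Record tensalg := Tensalg { tval :> series; tvalP : tval \in finsupp }.
HB.instance Definition _ := [isSub for tval].
HB.instance Definition _ := [Choice of tensalg by <:].
HB.instance Definition _ := GRing.SubChoice_isSubPzRing.Build series finsupp
  tensalg finsupp_subring.
HB.instance Definition _ := [SubZmodule_isSubLmodule of tensalg by <:].

Lemma homs_finsupp i (x : tpow i) : homs x \in finsupp.
Proof.
apply/finsuppP; exists i.+1 => j hj; apply: homsN.
by apply: contraTneq hj => ->; rewrite ltnn.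
Qed.

Definition homt (i : nat) (x : tpow i) : tensalg := Tensalg (homs_finsupp x).

Definition iotaT (s : E) : tensalg := homt (s : tpow 0).
Definition iotaM (m : M) : tensalg := homt (tcons m (1 : tpow 0)).
Definition iotaF (s : E) : series := homs (s : tpow 0).

End Modules.

Section Idempotents.
Variables (F : fieldType) (n : nat) (E_ : 'I_n -> falgType F).
Local Notation E := (prodalg E_).

Definition eidem (i : 'I_n) : E := pa_fun (fun j => if j == i then 1 else 0).

Definition Zalg : {vspace E} := (\sum_i <[eidem i]>)%VS.

Definition eE (i : 'I_n) : {vspace E} :=
  (linfun (fun x => eidem i * x) @: fullv)%VS.

End Idempotents.

Section Jacobian.
Variables (F : fieldType) (n : nat) (E_ : 'I_n -> falgType F).
Local Notation E := (prodalg E_).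
Local Notation e := (@eidem F n E_).
Local Notation Z := (subvs_of (Zalg E_)).
Variable M : bimodule E_.
Local Notation T := (tensalg M).
Local Notation FM := (series M).

Section FreeGenerator.
Variable M0 : {vspace M}.

Definition Z_subbimodule : Prop :=
  forall z m, z \in Zalg E_ -> m \in M0 ->
    lact z m \in M0 /\ ract m z \in M0.

(** [Z] acts on [E] by multiplication, and on [M0] by restricting the actions
  on [M]: when [M0] is a subbimodule, [vsproj M0] only changes the type. *)

Definition E_ractZ (x : E) (z : Z) : E := x * vsval z.
Definition E_lactZ (z : Z) (x : E) : E := vsval z * x.
Definition M0_lactZ (z : Z) (m : subvs_of M0) : subvs_of M0 :=
  vsproj M0 (lact (vsval z) (vsval m)).
Definition M0_ractZ (m : subvs_of M0) (z : Z) : subvs_of M0 :=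
  vsproj M0 (ract (vsval m) (vsval z)).

Definition E_M0 : lmodType F := tens E_ractZ M0_lactZ.

Definition E_M0_ractZ (x : E_M0) (z : Z) : E_M0 :=
  tlift (fun s m => tpure E_ractZ M0_lactZ s (M0_ractZ m z)) x.

Definition E_M0_E : lmodType F := tens E_M0_ractZ E_lactZ.

Definition mult_map (x : E_M0_E) : M :=
  tlift (fun y s' => ract (tlift (fun s m => lact s (vsval m)) y) s') x.

(** The multiplication map is a morphism of bimodules by construction, so that
  being an isomorphism is being bijective. *)

Definition Z_free_generator : Prop := Z_subbimodule /\ bijective mult_map.

Definition eM0e (i j : 'I_n) : {vspace M} :=
  (linfun (fun m => ract (lact (e i) m) (e j)) @: M0)%VS.

End FreeGenerator.

Definition T_ractZ (x : T) (z : Z) : T := x * iotaT M (vsval z).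
Definition T_lactZ (z : Z) (x : T) : T := iotaT M (vsval z) * x.

Definition TZT : lmodType F := tens T_ractZ T_lactZ.

Definition tzt (a b : T) : TZT := tpure T_ractZ T_lactZ a b.

(** The outer [T]-[T]-bimodule structure [f (a (x) b) g = fa (x) bg]. *)

Definition TZT_lact (f : T) (x : TZT) : TZT :=
  tlift (fun a b : T => tzt (f * a) b) x.
Definition TZT_ract (x : TZT) (g : T) : TZT :=
  tlift (fun a b : T => tzt a (b * g)) x.

Definition F_derivation (D : T -> TZT) : Prop :=
  (forall (k : F) (f g : T), D (k *: f + g) = k *: D f + D g) /\
  (forall f g : T, D (f * g) = TZT_ract (D f) g + TZT_lact f (D g)).

Definition is_Delta (M0 : {vspace M}) (D : T -> TZT) : Prop :=
  [/\ F_derivation D,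
      forall s : E, D (iotaT M s) = tzt 1 (iotaT M s) - tzt (iotaT M s) 1 &
      forall m : M, m \in M0 -> D (iotaM m) = tzt 1 (iotaM m)].

Definition u_map (x : TZT) : T :=
  tlift (fun a b : T => \sum_i iotaT M (e i) * b * a * iotaT M (e i)) x.

Definition hT (D : T -> TZT) (f g : T) : T := u_map (TZT_ract (D f) g).

(** [hT D (f i) (g j)] is homogeneous of degree [i + j], so that it is
  determined by its component of degree [l = i + j]. *)

Definition hF (D : T -> TZT) (f g : FM) : FM := fun l =>
  \sum_(i < l.+1) tval (hT D (homt (f i)) (homt (g (l - i)%N))) l.

Definition delta (D : T -> TZT) (f : FM) : FM := hF D f 1.

Definition right_linear (psi : M -> E) : Prop :=
  (forall m m', psi (m + m') = psi m + psi m') /\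
  (forall m a, psi (ract m a) = psi m * a).

(** [psi (m (x) y) = psi(m) y], which lowers degrees by one. *)

Definition psi_ext (psi : M -> E) (f : FM) : FM := fun d =>
  tlift (fun m (y : tpow M d) => lm_act (psi m) y) (f d.+1).

Definition delta_psi (D : T -> TZT) (psi : M -> E) (f : FM) : FM :=
  psi_ext psi (delta D f).

Definition potential (P : FM) : Prop :=
  P = \sum_i iotaF M (e i) * P * iotaF M (e i).

(** [dual s a] is [(s a)^*], for [a] in [A i j] and [s] in [L i]. *)

Definition is_dual (L : 'I_n -> seq E) (A : 'I_n -> 'I_n -> seq M)
    (dual : E -> M -> (M -> E)) : Prop :=
  forall i j a s, a \in A i j -> s \in L i ->
  [/\ right_linear (dual s a),
      dual s a (lact s a) = e j &
      forall i' j' a' s', a' \in A i' j' -> s' \in L i' ->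
        (s', a') != (s, a) -> dual s a (lact s' a') = 0].

(** [X_{a^*}(P)] for [a] in [A i j], i.e., [i = tau(a)] *)

Definition Xder (D : T -> TZT) (L : 'I_n -> seq E) (dual : E -> M -> (M -> E))
    (i : 'I_n) (a : M) (P : FM) : FM :=
  \sum_(s <- L i) delta_psi D (dual s a) P * iotaF M s.

Definition two_sided_ideal (I : set FM) : Prop :=
  [/\ I 0, forall f g, I f -> I g -> I (f + g),
      forall f g, I g -> I (f * g) & forall f g, I f -> I (f * g)].

Definition ideal_gen (X : set FM) : set FM :=
  fun f => forall I, two_sided_ideal I -> (forall g, X g -> I g) -> I f.

(** [d(f, g) = 2^{-nu(f - g)}]; all its values are rational, so that testing
  the closure with rational [eps] is enough. *)

Definition dist (f g : FM) : rat :=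
  match pselect (exists i, (f - g) i != 0) with
  | left h => 2%:R ^- ex_minn h
  | right _ => 0
  end.

Definition metric_closure (X : set FM) : set FM :=
  fun f => forall eps : rat, 0 < eps -> exists2 g, X g & dist f g < eps.

Definition jacobian_ideal (D : T -> TZT) (L : 'I_n -> seq E)
    (A : 'I_n -> 'I_n -> seq M) (dual : E -> M -> (M -> E)) (P : FM) : set FM :=
  metric_closure (ideal_gen
    (fun f => exists i j a, a \in A i j /\ f = Xder D L dual i a P)).

End Jacobian.

Definition left_ideal (F : fieldType) (B : falgType F) (I : {vspace B}) : Prop :=
  forall a x : B, x \in I -> a * x \in I.

Definition semisimple (F : fieldType) (B : falgType F) : Prop :=
  forall I : {vspace B}, left_ideal I ->
  exists J : {vspace B}, [/\ left_ideal J, (I + J)%VS = fullv & (I :&: J)%VS = 0%VS].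

(* Main.v *)
From HB Require Import structures.
Require Import Defs.
From mathcomp Require Import all_boot all_order all_algebra all_field.
From mathcomp Require Import boolp classical_sets.

(** The element [X_{a^*}(P)] is the contraction, by the functionals [(s a)^*],
  of the cyclic derivative [delta(P)].  Changing the generator changes both the
  derivative and the functionals, and the two effects can be treated one after
  the other.

  The contraction [C_a(w) = \sum_s (s a)^*(w) s] is a trace over [E], i.e.,
  [C_a(b w) = C_a(w b)] for [b] in [E].  Indeed, for [b] in [e_i E] the
  coordinates of [b a t] on the [s a] are those of [b] on the [s], so that
  summing them back against the [s] moves [b] from the front of the word to its
  back ([contr_arrow], [contr_rot]).

  After any trace [tr] over [E], the cyclic derivation [h(f)(g) = u(Delta(f) g)]
  forgets the generator.  It obeys
  [h(f f')(g) = h(f)(f' g) + h(f')(g f)] ([hT_mul]), because [u] closes words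
  up into cycles; hence it is enough to know [tr(h(f)(g))] for [f] in [E] and
  in [M].  It is [0] for [f] in [E], where it equals [tr(f g - g f)].
  For [f = s m t] with [m] in [M_0], only the derivative of [m] survives, and
  this leaves [tr(m t g s) = tr(f g)], where [M_0] no longer appears
  ([E_trace_hT_M]).  So [C_a(delta(P))] is the same for [M_0] and [M_0']
  ([E_trace_hT_indep]).

  The contractions for [M_0'] are combinations of those for [M_0] with
  coefficients in [E] ([contr_change]):
  [C_{a'}(w) = \sum_{a, s} (s a')^*(a) C_a(w) s], with [s] in the basis
  [L'(tau(a'))].  Taking [w = delta(P)], each generator of the ideal of one
  side lies in the ideal of the other, and the closures agree. *)

Set Implicit Arguments.
Unset Strict Implicit.
Unset Printing Implicit Defensive.

Import GRing.Theory.
Local Open Scope ring_scope.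

(** * Idempotents and bimodules *)

Lemma span_ind (F : fieldType) (V : vectType F) (X : seq V) (Q : V -> Prop) :
  Q 0 -> (forall x y, Q x -> Q y -> Q (x + y)) ->
  (forall c x, x \in X -> Q (c *: x)) -> forall v, v \in <<X>>%VS -> Q v.
Proof.
move=> Q0 QD QX v vX; rewrite (coord_span (X := in_tuple X) vX).
by elim/big_ind: _ => // k _; apply: QX; exact: mem_nth.
Qed.

Section Bimodules.
Variables (F : fieldType) (n : nat) (E_ : 'I_n -> falgType F).
Local Notation E := (prodalg E_).
Variable M : bimodule E_.
Local Notation e := (@eidem F n E_).

Lemma eidem_central i (b : E) : e i * b = b * e i.
Proof.
apply: pa_eqP => j; rewrite !pa_mulE !pa_valE.
by case: eqP; rewrite ?mulr1 ?mul1r ?mulr0 ?mul0r.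
Qed.

Lemma eidem_idem i : e i * e i = e i.
Proof.
apply: pa_eqP => j; rewrite !pa_mulE !pa_valE.
by case: eqP; rewrite ?mulr1 ?mulr0.
Qed.

Lemma eidem_orth i j : i != j -> e i * e j = 0.
Proof.
move=> ne; apply: pa_eqP => l; rewrite !pa_mulE !pa_valE.
by case: (eqVneq l i) => [->|_]; rewrite ?mul0r // (negbTE ne) mulr0.
Qed.

Lemma sum_eidem : \sum_i e i = 1.
Proof.
apply: pa_eqP => j; rewrite !pa_valE.
have -> : pa_val (\sum_i e i) j = \sum_i pa_val (e i) j.
  apply: (big_morph (fun x : E => pa_val x j)); last exact: pa_valE.
  by move=> x y; exact: pa_addE.
rewrite (bigD1 j) //= !pa_valE eqxx big1 ?addr0 // => i ne.
by rewrite pa_valE eq_sym (negbTE ne).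
Qed.

Lemma Zalg_eidem (z : E) i : z \in Zalg E_ -> exists c, e i * z = c *: e i.
Proof.
case/memv_sumP => v hv ->.
have /vlineP [c hc] := hv i isT; exists c.
rewrite mulr_sumr (bigD1 i) //= hc -pa_scaleAr eidem_idem.
rewrite big1 ?addr0 // => j ne.
have /vlineP [k ->] := hv j isT.
by rewrite -pa_scaleAr eidem_orth 1?eq_sym // scaler0.
Qed.

Lemma lactZl k b (m : M) : lact (k *: b) m = k *: lact b m.
Proof. by rewrite -[k *: b]mul1r -pa_scaleAr pa_scaleAl lactM lactF. Qed.

Lemma lact0 b : lact b (0 : M) = 0.
Proof. by rewrite -(scale0r 0) lactZ !scale0r. Qed.

Lemma l0act (m : M) : lact 0 m = 0.
Proof. by rewrite -(scale0r (1 : E)) lactF scale0r. Qed.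

Lemma r0act b : ract (0 : M) b = 0.
Proof. by rewrite -(scale0r 0) ractZ !scale0r. Qed.

Lemma ract0 (m : M) : ract m 0 = 0.
Proof. by rewrite -(scale0r (1 : E)) ractF scale0r. Qed.

(** The spaces [e_i E] and [e_i M_0 e_j] are images of the next two maps, which
  are named so as to carry a structure of linear map. *)
Definition eidem_lmul i (x : E) : E := e i * x.

Fact eidem_lmul_linear i : linear (eidem_lmul i).
Proof. by move=> k x y; rewrite /eidem_lmul mulrDr -pa_scaleAr. Qed.

HB.instance Definition _ (i : 'I_n) :=
  GRing.isLinear.Build F E E _ (eidem_lmul i) (eidem_lmul_linear i).

Definition corner i j (m : M) : M := ract (lact (e i) m) (e j).

Fact corner_linear i j : linear (corner i j).
Proof. by move=> k x y; rewrite /corner lactDr ractDl lactZ ractZ. Qed.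

HB.instance Definition _ (i j : 'I_n) :=
  GRing.isLinear.Build F M M _ (corner i j) (corner_linear i j).

Lemma mem_eE i b : e i * b = b -> b \in eE E_ i.
Proof.
move=> h; rewrite -h; have := memv_img (linfun (eidem_lmul i)) (memvf b).
by rewrite lfunE.
Qed.

Lemma mem_eM0e (M0 : {vspace M}) i j m :
  m \in M0 -> ract (lact (e i) m) (e j) \in eM0e M0 i j.
Proof.
by move=> h; have := memv_img (linfun (corner i j)) h; rewrite lfunE.
Qed.

Lemma eM0e_fix (M0 : {vspace M}) i j m :
  m \in eM0e M0 i j -> lact (e i) m = m /\ ract m (e j) = m.
Proof.
case/memv_imgP => x _ ->.
have -> : linfun (fun m : M => ract (lact (e i) m) (e j)) x =
  ract (lact (e i) x) (e j) := lfunE (corner i j) x.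
by rewrite -!lractA -!lactM !lractA -!ractM !eidem_idem.
Qed.

(** A [Z]-free generator generates [M] as a bimodule: this is the surjectivity
  of the multiplication map. *)
Lemma Z_free_ind (M0 : {vspace M}) (Q : M -> Prop) :
  Z_free_generator M0 -> Q 0 -> (forall x y, Q x -> Q y -> Q (x + y)) ->
  (forall s m t, m \in M0 -> Q (lact s (ract m t))) -> forall m, Q m.
Proof.
move=> [_ [g _ gK]] Q0 QD QM m; rewrite -(gK m) /mult_map /tlift.
(* [tlift] is a sum over a representative, whose terms have the right form. *)
elim/big_ind: _ => // -[y t] _ /=.
have ract_sum : {morph (fun x : M => ract x t) : x y / x + y}.
  by move=> x z; exact: ractDl.
have ract0 : ract (0 : M) t = 0 by rewrite -(scale0r 0) ractZ !scale0r.
rewrite (big_morph _ ract_sum ract0); elim/big_ind: _ => // -[s x] _ /=.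
by rewrite lractA; apply: QM; exact: subvsP.
Qed.

End Bimodules.

(** * Homogeneous series *)

Section Homogeneous.
Variables (F : fieldType) (n : nat) (E_ : 'I_n -> falgType F).
Local Notation E := (prodalg E_).
Variable M : bimodule E_.
Local Notation FM := (series M).
Local Notation T := (tensalg M).

Lemma homsD i (x y : tpow M i) : homs (x + y) = homs x + homs y.
Proof.
apply: seriesP => d; rewrite s_addE; case: (eqVneq i d) => [<-|ne].
  by rewrite !homsE.
by rewrite !homsN // addr0.
Qed.

Lemma homs0 i : homs (0 : tpow M i) = 0.
Proof.
apply: seriesP => d; case: (eqVneq i d) => [<-|ne]; first by rewrite homsE.
by rewrite homsN.
Qed.

Lemma homsZ i k (x : tpow M i) : homs (k *: x) = k *: homs x.
Proof.
apply: seriesP => d; rewrite [RHS]/(k *: homs x d).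
case: (eqVneq i d) => [<-|ne]; first by rewrite !homsE.
by rewrite !homsN //; symmetry; exact: scaler0.
Qed.

Lemma homs_mulE s (x : tpow M s) g d : (homs x * g) d = lmul x g d.
Proof.
rewrite s_mulE; case: (leqP s d) => h.
  rewrite (bigD1 (Ordinal (h : (s < d.+1)%N))) //= homsE big1 ?addr0 // => t nt.
  rewrite homsN ?lmul0l //; apply: contra nt => /eqP e.
  by apply/eqP/val_inj.
rewrite lmul_lt // big1 // => t _; rewrite homsN ?lmul0l //.
by apply: contraTneq (ltn_ord t) => <-; rewrite -leqNgt.
Qed.

Lemma lmulZr s (x : tpow M s) k g d : lmul x (k *: g) d = k *: lmul x g d.
Proof.
move: x d; elim/tpow_ind => {s}.
- by move=> a d; exact: lm_actZ.
- by move=> s d; rewrite !lmul0l scaler0.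
- by move=> s x y hx hy d; rewrite !lmulDl hx hy scalerDr.
- move=> s m y hy [|d]; first by rewrite /= scaler0.
  by rewrite !lmul_cons hy; exact: tpureZr.
Qed.

Lemma s_scaleAl k (f g : FM) : k *: f * g = k *: (f * g).
Proof.
apply: seriesP => d.
transitivity (k *: (\sum_(s < d.+1) lmul (f s) g d)); last by [].
rewrite s_mulE scaler_sumr.
by apply: eq_bigr => s _; rewrite lmulZl.
Qed.

Lemma s_scaleAr k (f g : FM) : f * (k *: g) = k *: (f * g).
Proof.
apply: seriesP => d.
transitivity (k *: (\sum_(s < d.+1) lmul (f s) g d)); last by [].
rewrite s_mulE scaler_sumr.
by apply: eq_bigr => s _; rewrite lmulZr.
Qed.

Lemma homs_act b i (x : tpow M i) : homs (lm_act b x) = iotaF M b * homs x.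
Proof.
apply: seriesP => d; rewrite homs_mulE /=.
case: (eqVneq i d) => [<-|ne]; first by rewrite !homsE.
by rewrite !homsN // lm_act0.
Qed.

Lemma homs_tcons m i (x : tpow M i) :
  homs (tcons m x) = homs (tcons m (1 : tpow M 0)) * homs x.
Proof.
apply: seriesP => -[|d]; rewrite homs_mulE; first by rewrite homsN.
rewrite lmul_cons /= lm_act1; case: (eqVneq i d) => [<-|ne].
  by rewrite !homsE.
by rewrite !homsN //; symmetry; exact: tpure0r.
Qed.

Lemma iotaFM a b : iotaF M (a * b) = iotaF M a * iotaF M b.
Proof. exact: homs_act. Qed.

Lemma iotaF1 : iotaF M 1 = 1.
Proof.
apply: seriesP => -[|d]; last exact: homsN.
exact: (homsE (1 : tpow M 0)).
Qed.

Lemma mul_iotaFE (f : FM) b d : (f * iotaF M b) d = lmul (f d) (iotaF M b) d.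
Proof.
rewrite s_mulE big_ord_recr /= big1 ?add0r // => s _.
apply: (@lmul_large _ _ _ M s (f s) (iotaF M b) 1%N).
  by case=> // j _; exact: homsN.
by rewrite addn1; exact: ltn_ord.
Qed.

Definition rscale d (x : tpow M d) (b : E) : tpow M d := lmul x (iotaF M b) d.

Lemma rscaleM d (x : tpow M d) b c : rscale x (b * c) = rscale (rscale x b) c.
Proof.
by rewrite /rscale iotaFM [LHS](lmul_mul x) -[RHS]mul_iotaFE.
Qed.

Lemma rscaleDr d (x : tpow M d) b c :
  rscale x (b + c) = rscale x b + rscale x c.
Proof. by rewrite /rscale /iotaF homsD lmulDr. Qed.

Lemma rscaleZr d k (x : tpow M d) b : rscale x (k *: b) = k *: rscale x b.
Proof. by rewrite /rscale /iotaF homsZ lmulZr. Qed.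

Lemma rscale0r d (x : tpow M d) : rscale x 0 = 0.
Proof. by rewrite -(scale0r (0 : E)) rscaleZr scale0r. Qed.

Lemma rscale_tcons d m (x : tpow M d) b :
  rscale (tcons m x) b = tcons m (rscale x b).
Proof. exact: lmul_cons. Qed.

Lemma T_scaleAl k (f g : T) : k *: f * g = k *: (f * g).
Proof. by apply: val_inj; rewrite /= [LHS]s_scaleAl. Qed.

Lemma T_scaleAr k (f g : T) : f * (k *: g) = k *: (f * g).
Proof. by apply: val_inj; rewrite /= [LHS]s_scaleAr. Qed.

Lemma iotaTM a b : iotaT M (a * b) = iotaT M a * iotaT M b.
Proof. by apply: val_inj; exact: iotaFM. Qed.

Lemma iotaTZ k b : iotaT M (k *: b) = k *: iotaT M b.
Proof. by apply: val_inj; exact: homsZ. Qed.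

Lemma homtD i (x y : tpow M i) : homt (x + y) = homt x + homt y.
Proof. by apply: val_inj; exact: homsD. Qed.

Lemma homt0 i : homt (0 : tpow M i) = 0.
Proof. by apply: val_inj; exact: homs0. Qed.

Lemma homt_tcons m i (x : tpow M i) : homt (tcons m x) = iotaM m * homt x.
Proof. by apply: val_inj; exact: homs_tcons. Qed.

Lemma iotaM0 : iotaM (0 : M) = 0.
Proof. by rewrite /iotaM /tcons tpure0l homt0. Qed.

Lemma iotaMD (m m' : M) : iotaM (m + m') = iotaM m + iotaM m'.
Proof. by rewrite /iotaM /tcons tpureDl homtD. Qed.

Lemma iotaM_lract s (m : M) t :
  iotaM (lact s (ract m t)) = iotaT M s * iotaM m * iotaT M t.
Proof.
rewrite -mulrA -homt_tcons; apply: val_inj.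
rewrite /= -homs_act; congr homs.
rewrite /= tensE_act_pure /tcons.
rewrite -lractA tpure_bal; congr tpure.
exact: mulr1.
Qed.

End Homogeneous.

(** * The cyclic derivation *)

Section CyclicDerivation.
Variables (F : fieldType) (n : nat) (E_ : 'I_n -> falgType F).
Local Notation E := (prodalg E_).
Variable M : bimodule E_.
Local Notation T := (tensalg M).
Local Notation e := (@eidem F n E_).

Lemma u_map_bal : balanced (@T_ractZ _ _ _ M) (@T_lactZ _ _ _ M)
  (fun a b : T => \sum_i iotaT M (e i) * b * a * iotaT M (e i)).
Proof.
split.
- move=> a a' b; rewrite -big_split; apply: eq_bigr => i _.
  by rewrite mulrDr mulrDl.
- move=> a b b'; rewrite -big_split; apply: eq_bigr => i _.
  by rewrite mulrDr !mulrDl.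
- move=> k a b; apply: eq_bigr => i _.
  by rewrite !T_scaleAr !T_scaleAl.
- move=> k a z b; apply: eq_bigr => i _.
  rewrite /T_ractZ /T_lactZ !T_scaleAr !T_scaleAl; congr (_ *: _).
  (* [e_i z] is a scalar multiple of [e_i], so it moves across [b a]. *)
  have [c hc] := Zalg_eidem i (subvsP z).
  transitivity (iotaT M (e i) * b * a * iotaT M (vsval z * e i)).
    by rewrite iotaTM !mulrA.
  rewrite -eidem_central hc !mulrA -iotaTM hc !iotaTZ.
  by rewrite !T_scaleAr !T_scaleAl.
Qed.

Lemma u_mapD (x y : TZT M) : u_map (x + y) = u_map x + u_map y :> T.
Proof. exact: tliftD u_map_bal x y. Qed.

Lemma u_map0 : u_map 0 = 0 :> T.
Proof. exact: tlift0 u_map_bal. Qed.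

Lemma u_map_tzt (a b : T) :
  u_map (tzt a b) = \sum_i iotaT M (e i) * b * a * iotaT M (e i).
Proof. exact: tlift_pure u_map_bal a b. Qed.

Lemma TZT_lact_bal f : balanced (@T_ractZ _ _ _ M) (@T_lactZ _ _ _ M)
  (fun a b : T => tzt (f * a) b).
Proof.
split.
- by move=> a a' b; rewrite mulrDr /tzt tpureDl.
- by move=> a b b'; rewrite /tzt tpureDr.
- by move=> k a b; rewrite T_scaleAr /tzt tpureZl tpureZr.
- move=> k a z b; rewrite !T_scaleAr /tzt !tpureZl; congr (_ *: _).
  by rewrite -tpure_bal /T_ractZ mulrA.
Qed.

Lemma TZT_lactD (f : T) (x y : TZT M) :
  TZT_lact f (x + y) = TZT_lact f x + TZT_lact f y.
Proof. exact: tliftD (TZT_lact_bal f) x y. Qed.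

Lemma TZT_lact0 (f : T) : TZT_lact f 0 = 0 :> TZT M.
Proof. exact: tlift0 (TZT_lact_bal f). Qed.

Lemma TZT_lact_tzt (f a b : T) : TZT_lact f (tzt a b) = tzt (f * a) b.
Proof. exact: tlift_pure (TZT_lact_bal f) a b. Qed.

Lemma TZT_ract_bal g : balanced (@T_ractZ _ _ _ M) (@T_lactZ _ _ _ M)
  (fun a b : T => tzt a (b * g)).
Proof.
split.
- by move=> a a' b; rewrite /tzt tpureDl.
- by move=> a b b'; rewrite mulrDl /tzt tpureDr.
- by move=> k a b; rewrite T_scaleAl /tzt tpureZl tpureZr.
- move=> k a z b; rewrite /tzt !tpureZl tpure_bal; congr (_ *: _).
  by rewrite /T_lactZ mulrA.
Qed.

Lemma TZT_ractD (x y : TZT M) (g : T) :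
  TZT_ract (x + y) g = TZT_ract x g + TZT_ract y g.
Proof. exact: tliftD (TZT_ract_bal g) x y. Qed.

Lemma TZT_ract0 (g : T) : TZT_ract 0 g = 0 :> TZT M.
Proof. exact: tlift0 (TZT_ract_bal g). Qed.

Lemma TZT_ract_tzt (a b g : T) : TZT_ract (tzt a b) g = tzt a (b * g).
Proof. exact: tlift_pure (TZT_ract_bal g) a b. Qed.

Lemma TZT_ractM (x : TZT M) (f g : T) :
  TZT_ract (TZT_ract x f) g = TZT_ract x (f * g).
Proof.
elim/tens_ind: x => [|a b|x y hx hy]; first by rewrite !TZT_ract0.
  by rewrite -/(tzt a b) !TZT_ract_tzt mulrA.
by rewrite !TZT_ractD hx hy.
Qed.

(** [u] closes a word up into a cycle, so that a factor at the front can be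
  moved to the back. *)
Lemma u_map_cyclic (f g : T) (x : TZT M) :
  u_map (TZT_ract (TZT_lact f x) g) = u_map (TZT_ract x (g * f)).
Proof.
elim/tens_ind: x => [|a b|x y hx hy].
- by rewrite TZT_lact0 !TZT_ract0.
- rewrite -/(tzt a b) TZT_lact_tzt !TZT_ract_tzt !u_map_tzt.
  by apply: eq_bigr => i _; rewrite !mulrA.
- by rewrite TZT_lactD !TZT_ractD !u_mapD hx hy.
Qed.

Section Derivation.
Variable D : T -> TZT M.
Hypothesis DP : F_derivation D.

Lemma F_derivationD f g : D (f + g) = D f + D g.
Proof. by have := DP.1 1 f g; rewrite !scale1r. Qed.

(** The Leibniz rule of [Delta], read on cycles: in the second term [f1] stands
  before [Delta(f2)] and reaches the back of [g] by [u_map_cyclic]. *)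
Lemma hT_mul f1 f2 g : hT D (f1 * f2) g = hT D f1 (f2 * g) + hT D f2 (g * f1).
Proof.
by rewrite /hT DP.2 TZT_ractD u_mapD TZT_ractM u_map_cyclic.
Qed.

Lemma hTr0 f : hT D f 0 = 0.
Proof.
rewrite /hT; elim/tens_ind: (D f) => [|a b|x y hx hy].
- by rewrite TZT_ract0 u_map0.
- by rewrite TZT_ract_tzt mulr0 /tzt tpure0r u_map0.
- by rewrite TZT_ractD u_mapD hx hy addr0.
Qed.

Lemma hTD f1 f2 g : hT D (f1 + f2) g = hT D f1 g + hT D f2 g.
Proof. by rewrite /hT F_derivationD TZT_ractD u_mapD. Qed.

Lemma hT0 g : hT D 0 g = 0.
Proof. by apply: (@addIr _ (hT D 0 g)); rewrite -hTD !add0r. Qed.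

End Derivation.

End CyclicDerivation.

(** * Traces over [E] *)

Section Trace.
Variables (F : fieldType) (n : nat) (E_ : 'I_n -> falgType F).
Local Notation E := (prodalg E_).
Variable M : bimodule E_.
Local Notation FM := (series M).
Local Notation T := (tensalg M).
Local Notation e := (@eidem F n E_).

(** A trace over [E] only: invariance under the rotation of factors in [M] is
  not asked, because the contractions below do not have it in general. *)
Definition E_trace (V : zmodType) (tr : FM -> V) : Prop :=
  (forall f g, tr (f + g) = tr f + tr g) /\
  (forall b f, tr (iotaF M b * f) = tr (f * iotaF M b)).

Variables (V : zmodType) (tr : FM -> V).
Hypothesis trP : E_trace tr.

Lemma E_trace0 : tr 0 = 0.
Proof. by apply: (@addIr _ (tr 0)); rewrite -trP.1 !add0r. Qed.

Lemma E_trace_sum (I : Type) (s : seq I) (p : pred I) (G : I -> FM) :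
  tr (\sum_(i <- s | p i) G i) = \sum_(i <- s | p i) tr (G i).
Proof. exact: (big_morph tr trP.1 E_trace0). Qed.

(** A trace over [E] ignores the truncation by the [e_i] in the definition of
  [u]. *)
Lemma E_trace_corner f : tr (\sum_i iotaF M (e i) * f * iotaF M (e i)) = tr f.
Proof.
rewrite E_trace_sum.
transitivity (\sum_i tr (f * iotaF M (e i))).
  by apply: eq_bigr => i _; rewrite -mulrA trP.2 -mulrA -iotaFM eidem_idem.
rewrite -E_trace_sum -mulr_sumr; congr tr.
rewrite -[RHS]mulr1 -iotaF1 -sum_eidem; congr (_ * _).
symmetry; apply: (big_morph (iotaF M)); last exact: homs0.
by move=> a b; exact: homsD.
Qed.

Lemma E_trace_u_tzt (a b : T) :
  tr (u_map (tzt a b)) = tr ((b : FM) * (a : FM)).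
Proof.
rewrite u_map_tzt -[RHS]E_trace_corner; congr tr.
rewrite (big_morph val (fun x y : T => erefl (val (x + y)))
                   (erefl : val (0 : T) = 0)).
by apply: eq_bigr => i _; rewrite -!mulrA.
Qed.

Lemma E_trace_hT_E D b (g : T) :
  F_derivation D -> D (iotaT M b) = tzt 1 (iotaT M b) - tzt (iotaT M b) 1 ->
  tr (hT D (iotaT M b) g) = 0.
Proof.
move=> DP hb; apply: (@addIr _ (tr (u_map (TZT_ract (tzt (iotaT M b) 1) g)))).
rewrite add0r -trP.1.
transitivity (tr (u_map (TZT_ract (tzt 1 (iotaT M b)) g))).
  congr (tr _); rewrite -[RHS]/(val (u_map _)) /=.
  rewrite -[LHS]/(val (hT D (iotaT M b) g +
                       u_map (TZT_ract (tzt (iotaT M b) 1) g))).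
  by rewrite /hT -u_mapD -TZT_ractD hb subrK.
rewrite !TZT_ract_tzt !E_trace_u_tzt mul1r mulr1.
exact: trP.2.
Qed.

(** The right-hand side does not involve the generator.  For [x = s m t] with
  [m] in [M_0], the derivatives of [s] and [t] vanish under [tr], and [Delta(m)]
  contributes [tr(m t g s)], which is [tr(x g)] after moving [s] to the
  front. *)
Lemma E_trace_hT_M M0 D m (g : T) :
  Z_free_generator M0 -> is_Delta M0 D ->
  tr (hT D (iotaM m) g) = tr ((iotaM m : FM) * (g : FM)).
Proof.
move=> M0P [DP hE hM]; move: m g.
apply: (Z_free_ind M0P) => [|x y hx hy|s m t mM0] g.
- by rewrite iotaM0 (hT0 DP) mul0r !E_trace0.
- by rewrite iotaMD (hTD DP) mulrDl [LHS]trP.1 [RHS]trP.1 hx hy.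
rewrite iotaM_lract !(hT_mul DP) [LHS]trP.1 [X in X + _]trP.1.
rewrite !E_trace_hT_E // add0r addr0 {1}/hT hM // TZT_ract_tzt.
rewrite E_trace_u_tzt mulr1.
rewrite -[RHS]/(tr (iotaF M s * val (iotaM m) * iotaF M t * val g)).
by rewrite -!mulrA trP.2 !mulrA.
Qed.

(** By [hT_mul], [tr(h(f)(g))] is determined by its values for [f] in [E] and in
  [M], for all [g]. *)
Lemma E_trace_hT_indep M0 M0' D D' l (x : tpow M l) (g : T) :
  Z_free_generator M0 -> is_Delta M0 D ->
  Z_free_generator M0' -> is_Delta M0' D' ->
  tr (hT D (homt x) g) = tr (hT D' (homt x) g).
Proof.
move=> M0P DP M0'P D'P; have [dD hE _] := DP; have [dD' hE' _] := D'P.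
elim/tpow_ind: l / x g => [b|l|l x y hx hy|l m y hy] g.
- by rewrite !E_trace_hT_E.
- by rewrite homt0 !hT0.
- by rewrite homtD !hTD // [LHS]trP.1 [RHS]trP.1 hx hy.
- rewrite homt_tcons !hT_mul // [LHS]trP.1 [RHS]trP.1 hy.
  by rewrite (E_trace_hT_M _ _ M0P DP) (E_trace_hT_M _ _ M0'P D'P).
Qed.

End Trace.

(** * Contractions *)

Section Contraction.
Variables (F : fieldType) (n : nat) (E_ : 'I_n -> falgType F).
Local Notation E := (prodalg E_).
Variable M : bimodule E_.
Local Notation FM := (series M).
Local Notation e := (@eidem F n E_).

Section PsiExt.
Variable psi : M -> E.
Hypothesis psiP : right_linear psi.

Lemma right_linearZ k m : psi (k *: m) = k *: psi m.
Proof. by rewrite -ractF psiP.2 -pa_scaleAr mulr1. Qed.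

Lemma right_linear0 : psi 0 = 0.
Proof. by rewrite -(scale0r 0) right_linearZ scale0r. Qed.

Lemma psi_ext_bal d : balanced (@ract _ _ _ M) (@lm_act _ _ _ (tpow M d))
  (fun m (y : tpow M d) => lm_act (psi m) y).
Proof.
split.
- by move=> m m' y; rewrite psiP.1 lm_actDl.
- by move=> m y y'; rewrite lm_actDr.
- by move=> k m y; rewrite right_linearZ -lm_actF -lm_actM -pa_scaleAr mulr1.
- by move=> k m s y; rewrite !right_linearZ psiP.2 pa_scaleAl lm_actM.
Qed.

End PsiExt.

(** With [psi s = (s a)^*] and [B = L(tau(a))], this is the map that takes the
  degree [d + 1] component of [delta(P)] to the degree [d] component of
  [X_{a^*}(P)]. *)
Definition contr d (B : seq E) (psi : E -> M -> E) (x : tpow M d.+1) :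
    tpow M d :=
  \sum_(s <- B)
    rscale (tlift (fun m (y : tpow M d) => lm_act (psi s m) y) x) s.

Lemma XderE D L dual i a (P : FM) d :
  Xder D L dual i a P d = contr (L i) (fun s => dual s a) (delta D P d.+1).
Proof.
rewrite /Xder s_sumE; apply: eq_bigr => s _; exact: mul_iotaFE.
Qed.

Section ContrLinear.
Variables (B : seq E) (psi : E -> M -> E).
Hypothesis psiP : forall s, s \in B -> right_linear (psi s).

Lemma contrD d (x y : tpow M d.+1) :
  contr B psi (x + y) = contr B psi x + contr B psi y.
Proof.
rewrite /contr -big_split /=; apply: eq_big_seq => s sB.
by rewrite (tliftD (psi_ext_bal (psiP sB) d)) /rscale lmulDl.
Qed.

Lemma contr0 d : contr B psi (0 : tpow M d.+1) = 0.
Proof. by apply: (@addIr _ (contr B psi 0)); rewrite -contrD !add0r. Qed.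

Lemma contr_tcons d m (y : tpow M d) :
  contr B psi (tcons m y) = \sum_(s <- B) lm_act (psi s m) (rscale y s).
Proof.
apply: eq_big_seq => s sB.
by rewrite (tlift_pure (psi_ext_bal (psiP sB) d)) /rscale lmul_act.
Qed.

End ContrLinear.

Record dual_bases (M0 : {vspace M}) (L : 'I_n -> seq E)
    (A : 'I_n -> 'I_n -> seq M) (dual : E -> M -> M -> E) : Prop := DualBases {
  db_gen : Z_free_generator M0;
  db_L : forall i, basis_of (eE E_ i) (L i);
  db_A : forall i j, basis_of (eM0e M0 i j) (A i j);
  db_dual : is_dual L A dual }.

Section Bases.
Variables (M0 : {vspace M}) (L : 'I_n -> seq E) (A : 'I_n -> 'I_n -> seq M).
Variable dual : E -> M -> M -> E.
Hypothesis H : dual_bases M0 L A dual.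

Local Notation dcontr i a := (contr (L i) (fun s => dual s a)).

Lemma dual_linear i j a s :
  a \in A i j -> s \in L i -> right_linear (dual s a).
Proof. by move=> aA sL; have [] := db_dual H aA sL. Qed.

Lemma arrow_fix i j a :
  a \in A i j -> lact (e i) a = a /\ ract a (e j) = a.
Proof.
move=> aA; apply: (eM0e_fix (M0 := M0)).
by rewrite -(span_basis (db_A H i j)) memv_span.
Qed.

Lemma arrow_inj i j i' j' a :
  a \in A i j -> a \in A i' j' -> (i', j') = (i, j).
Proof.
move=> aA aA'; have [la ra] := arrow_fix aA; have [la' ra'] := arrow_fix aA'.
have a0 : a != 0 := free_not0 (basis_free (db_A H i j)) aA.
case: (eqVneq i' i) => [->|ne].
  case: (eqVneq j' j) => [->|ne] //.
  by rewrite -ra' -ra -ractM eidem_orth 1?eq_sym // ract0 eqxx in a0.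
by rewrite -la' -la -lactM eidem_orth // l0act eqxx in a0.
Qed.

(** The condition [e_i b = b] can be imposed because [b a = b e_i a] for [a] in
  [A(i, j)]; it makes [b] a combination of [L(i)]. *)
Lemma arrow_ind (Q : M -> Prop) :
  Q 0 -> (forall x y, Q x -> Q y -> Q (x + y)) ->
  (forall i j a b t, a \in A i j -> e i * b = b -> Q (lact b (ract a t))) ->
  forall m, Q m.
Proof.
move=> Q0 QD QA; apply: (Z_free_ind (db_gen H)) => // s m t mM0.
have lsum I (r : seq I) (G : I -> E) x :
    lact (\sum_(i <- r) G i) x = \sum_(i <- r) lact (G i) x :> M.
  apply: (big_morph (fun b => lact b x)); last exact: l0act.
  by move=> b c; exact: lactDl.
have rsum I (r : seq I) (G : I -> E) x :
    ract x (\sum_(i <- r) G i) = \sum_(i <- r) ract x (G i) :> M.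
  apply: (big_morph (ract x)); last exact: ract0.
  by move=> b c; exact: ractDr.
rewrite -[s]mulr1 -[t]mul1r -sum_eidem mulr_sumr mulr_suml lsum.
elim/big_ind: _ => // i _; rewrite rsum.
have lD : {morph lact (s * e i) : x y / x + y :> M}.
  by move=> x y; exact: lactDr.
rewrite (big_morph _ lD (lact0 M _)); elim/big_ind: _ => // j _.
have -> : lact (s * e i) (ract m (e j * t)) =
    lact (s * e i) (ract (ract (lact (e i) m) (e j)) t).
  by rewrite -ractM lractA -lactM -mulrA eidem_idem.
have := mem_eM0e i j mM0; rewrite -(span_basis (db_A H i j)).
move: (ract _ _); apply: span_ind => [|x y hx hy|c a aA].
- by rewrite r0act lact0.
- by rewrite ractDl lactDr; exact: QD.
- rewrite ractZ lactZ -lactZl; apply: QA aA _.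
  by rewrite -pa_scaleAr -eidem_central mulrA eidem_idem.
Qed.

(** [(s a)^*] reads the coordinate of [b] on [s], so that the sum over [s]
  rebuilds [b] at the other end of [y]. *)
Lemma contr_arrow i j a i' j' a' b t d (y : tpow M d) :
  a \in A i j -> a' \in A i' j' -> e i' * b = b ->
  dcontr i a (tcons (lact b (ract a' t)) y) =
  if a' == a then lm_act (e j * t) (rscale y b) else 0.
Proof.
move=> aA aA' /mem_eE; rewrite -(span_basis (db_L H i')).
have lin s : s \in L i -> right_linear (dual s a).
  by exact: dual_linear aA.
rewrite contr_tcons //; move: b; apply: span_ind => [|b c hb hc|k s' sL'].
- rewrite rscale0r lm_act0 if_same big1_seq // => s sL.
  by rewrite l0act right_linear0 ?lm_0act //; exact: lin.
- rewrite rscaleDr lm_actDr; set r := if _ then _ else _.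
  transitivity (\sum_(s <- L i)
     (lm_act (dual s a (lact b (ract a' t))) (rscale y s) +
      lm_act (dual s a (lact c (ract a' t))) (rscale y s))).
    by apply: eq_big_seq => s sL; rewrite lactDl (lin s sL).1 lm_actDl.
  by rewrite big_split /= hb hc /r; case: eqP => _; rewrite ?addr0.
- have step s : s \in L i ->
      lm_act (dual s a (lact (k *: s') (ract a' t))) (rscale y s) =
      k *: lm_act (dual s a (lact s' a') * t) (rscale y s).
    move=> sL; rewrite lactZl (right_linearZ (lin s sL)) -lractA (lin s sL).2.
    by rewrite -lm_actF -lm_actM -pa_scaleAl mul1r.
  rewrite (eq_big_seq _ step) -scaler_sumr rscaleZr lm_actZ.
  rewrite -[in RHS](scaler0 _ k) -fun_if.
  congr (_ *: _); case: eqP => [E1|ne].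
    (* The only surviving term of the sum over [L i] is that of [s = s']. *)
    rewrite E1 in aA' *; have [Ei _] := arrow_inj aA aA'; rewrite Ei in sL'.
    rewrite (bigD1_seq s') ?(free_uniq (basis_free (db_L H i))) //=.
    have [_ -> _] := db_dual H aA sL'.
    rewrite big1_seq ?addr0 // => s /andP [ne sL].
    have [_ _ h] := db_dual H aA sL.
    by rewrite (h i j) ?mul0r ?lm_0act //; apply: contra ne => /eqP [->].
  rewrite big1_seq // => s sL; have [_ _ h] := db_dual H aA sL.
  by rewrite (h i' j') ?mul0r ?lm_0act //; apply/eqP => -[_ /ne].
Qed.

(** On [c a' t (x) y] both sides are given by [contr_arrow]: the first puts
  [b c] at the back of [y], the second puts [c] at the back of [y b]. *)
Lemma contr_rot i j a b d (x : tpow M d.+1) :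
  a \in A i j -> dcontr i a (lm_act b x) = dcontr i a (rscale x b).
Proof.
move=> aA.
have lin s : s \in L i -> right_linear (dual s a).
  by exact: dual_linear aA.
elim/tens_ind: x => [|m y|x y hx hy].
- by rewrite lm_act0 /rscale lmul0l contr0.
- rewrite -/(tcons m y) rscale_tcons [lm_act _ _]tensE_act_pure
          -/(tcons (lact b m) y).
  move: m; apply: arrow_ind => [|m m' hm hm'|i' j' a' c t aA' cE].
  + by rewrite lact0 /tcons !tpure0l.
  + by rewrite lactDr /tcons !tpureDl !contrD // -/(tcons _ _) hm hm'.
  + rewrite -lactM !(contr_arrow _ _ aA aA') //; last first.
      by rewrite mulrA eidem_central -mulrA cE.
    by rewrite rscaleM.
- by rewrite lm_actDr /rscale lmulDl !contrD // hx hy.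
Qed.

Lemma contr_E_trace i j a : a \in A i j ->
  E_trace (fun w : FM => (fun d => dcontr i a (w d.+1)) : FM).
Proof.
move=> aA.
have lin s : s \in L i -> right_linear (dual s a).
  by exact: dual_linear aA.
split=> [f g|b f]; apply: seriesP => d; first by rewrite /= contrD.
by rewrite /= mul_iotaFE homs_mulE (contr_rot _ _ aA).
Qed.

End Bases.

(** On [b a t (x) y], the contraction for [a] gives [t y b], and the one for
  [a'] gives [\sum_s (s a')^*(a) t y b s]: it sees [a] through its expansion in
  terms of [M_0'], and rotates [b] like every trace over [E]. *)
Lemma contr_change M0 L A dual M0' L' A' dual' i' j' a' d (x : tpow M d.+1) :
  dual_bases M0 L A dual -> dual_bases M0' L' A' dual' ->
  a' \in A' i' j' ->
  contr (L' i') (fun s => dual' s a') x =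
  \sum_(p : 'I_n * 'I_n) \sum_(a <- A p.1 p.2) \sum_(s <- L' i')
    lm_act (dual' s a' a)
      (rscale (contr (L p.1) (fun s0 => dual s0 a) x) s).
Proof.
move=> H H' aA'.
have lin i j a : a \in A i j -> forall s, s \in L i -> right_linear (dual s a).
  by move=> aA s sL; exact: (dual_linear H aA sL).
have lin' s : s \in L' i' -> right_linear (dual' s a').
  by move=> sL; exact: (dual_linear H' aA' sL).
pose G (x : tpow M d.+1) := \sum_(p : 'I_n * 'I_n) \sum_(a <- A p.1 p.2)
  \sum_(s <- L' i') lm_act (dual' s a' a)
    (rscale (contr (L p.1) (fun s0 => dual s0 a) x) s).
have GD x1 x2 : G (x1 + x2) = G x1 + G x2.
  rewrite /G -big_split; apply: eq_bigr => p _ /=.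
  rewrite -big_split; apply: eq_big_seq => a aA /=.
  rewrite -big_split; apply: eq_bigr => s _ /=.
  by rewrite (contrD (lin _ _ _ aA)) /rscale lmulDl lm_actDr.
have G0 : G 0 = 0 by apply: (@addIr _ (G 0)); rewrite -GD !add0r.
rewrite -/(G x); elim/tens_ind: x => [|m y|x1 x2 h1 h2].
- by rewrite contr0.
- rewrite -/(tcons m y); move: m; apply: (arrow_ind H).
  + by rewrite /tcons tpure0l contr0.
  + move=> m m' hm hm'.
    by rewrite /tcons tpureDl contrD // GD -!/(tcons _ _) hm hm'.
  move=> i j a b t aA bE.
  (* On the left, the front factor [b] is rotated to the back, and
     [(s a')^*] evaluates [a t]. *)
  rewrite -[tcons _ _]tensE_act_pure [LHS](contr_rot H' _ _ aA').
  rewrite -/(tcons _ _) rscale_tcons contr_tcons //.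
  rewrite [X in _ = G X]tensE_act_pure -/(tcons _ _).
  (* On the right, the contraction by any element but [a] itself vanishes. *)
  rewrite /G (bigD1 (i, j)) //=.
  rewrite (bigD1_seq a) ?(free_uniq (basis_free (db_A H i j))) //=.
  rewrite [X in _ + X + _]big1_seq ?addr0; last first.
    move=> a1 /andP [ne a1A]; rewrite big1 // => s _.
    rewrite (contr_arrow H _ _ a1A aA bE) eq_sym (negbTE ne).
    by rewrite /rscale lmul0l lm_act0.
  rewrite [X in _ + X]big1 ?addr0; last first.
    move=> [i1 j1] ne; rewrite big1_seq // => a1 /= a1A.
    rewrite big1 // => s _.
    rewrite (contr_arrow H _ _ a1A aA bE).
    case: eqP => [Ea|_]; last by rewrite /rscale lmul0l lm_act0.
    by rewrite -Ea in a1A; rewrite (arrow_inj H aA a1A) eqxx in ne.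
  apply: eq_big_seq => s sL'.
  rewrite (contr_arrow H _ _ aA aA bE) eqxx.
  have [_ aE] := arrow_fix H aA.
  rewrite [in RHS]/rscale lmul_act -lm_actM mulrA -(lin' s sL').2 aE.
  by rewrite -(lin' s sL').2.
- by rewrite contrD // GD h1 h2.
Qed.

End Contraction.

(** * Comparison of the ideals *)

Section Ideals.
Local Open Scope classical_set_scope.
Variables (F : fieldType) (n : nat) (E_ : 'I_n -> falgType F).
Variable M : bimodule E_.
Local Notation FM := (series M).
Local Notation T := (tensalg M).

Lemma homt_one_gt0 d : (0 < d)%N -> homt ((1 : FM) d) = 0.
Proof. by case: d => // d _; exact: homt0. Qed.

Lemma delta_top (D : T -> TZT M) (P : FM) d :
  F_derivation D -> delta D P d = (hT D (homt (P d)) 1 : FM) d.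
Proof.
move=> DP; rewrite /delta /hF big_ord_recr /= subnn.
have -> : homt ((1 : FM) 0%N) = 1 by apply: val_inj; exact: iotaF1.
rewrite big1 ?add0r // => i _.
by rewrite homt_one_gt0 ?subn_gt0 // hTr0.
Qed.

(** The contraction for [M_0'] does not distinguish the two derivatives; it can
  therefore be expanded, as a map, over the contractions for [M_0]. *)
Lemma Xder_mem_ideal M0 L A dual Delta M0' L' A' dual' Delta' i' j' a'
    (P : FM) (I : set FM) :
  dual_bases M0 L A dual -> is_Delta M0 Delta ->
  dual_bases M0' L' A' dual' -> is_Delta M0' Delta' ->
  two_sided_ideal I ->
  (forall i j a, a \in A i j -> I (Xder Delta L dual i a P)) ->
  a' \in A' i' j' -> I (Xder Delta' L' dual' i' a' P).
Proof.
move=> H DP H' DP' [I0 ID IMl IMr] IX aA'.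
have -> : Xder Delta' L' dual' i' a' P =
    \sum_(p : 'I_n * 'I_n) \sum_(a <- A p.1 p.2) \sum_(s <- L' i')
      iotaF M (dual' s a' a) * Xder Delta L dual p.1 a P * iotaF M s.
  apply: seriesP => d; rewrite XderE.
  have -> : contr (L' i') (fun s => dual' s a') (delta Delta' P d.+1) =
      contr (L' i') (fun s => dual' s a') (delta Delta P d.+1).
    have [dD _ _] := DP; have [dD' _ _] := DP'.
    rewrite !delta_top //.
    have tr := contr_E_trace H' aA'.
    have := E_trace_hT_indep tr (P d.+1) 1 (db_gen H') DP' (db_gen H) DP.
    by move/(congr1 (fun f : FM => f d)).
  rewrite (contr_change _ H H' aA').
  rewrite s_sumE; apply: eq_bigr => p _; rewrite s_sumE; apply: eq_bigr => a _.
  rewrite s_sumE; apply: eq_bigr => s _.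
  by rewrite mul_iotaFE homs_mulE lmul_act XderE.
elim/big_ind: _ => // p _; rewrite big_seq; elim/big_ind: _ => // a aA.
by elim/big_ind: _ => // s _; apply/IMr/IMl/(IX _ _ _ aA).
Qed.

Lemma metric_closureS (X Y : set FM) :
  X `<=` Y -> metric_closure X `<=` metric_closure Y.
Proof. by move=> XY f hf eps /hf [g /XY Yg h]; exists g. Qed.

Lemma jacobian_idealS M0 L A dual Delta M0' L' A' dual' Delta' (P : FM) :
  dual_bases M0 L A dual -> is_Delta M0 Delta ->
  dual_bases M0' L' A' dual' -> is_Delta M0' Delta' ->
  jacobian_ideal Delta' L' A' dual' P `<=` jacobian_ideal Delta L A dual P.
Proof.
move=> H DP H' DP'.
apply: metric_closureS => f hf I idI hI.
apply: hf => // _ [i' [j' [a' [aA' ->]]]].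
apply: (Xder_mem_ideal H DP H' DP' idI _ aA').
by move=> i j a aA; apply: hI; exists i, j, a.
Qed.

End Ideals.

Theorem proposition4p8 (F : fieldType) (n : nat) (E_ : 'I_n -> falgType F)
  (semisimpleE : forall i, semisimple (E_ i))
  (M : bimodule E_)
  (M0 : {vspace M}) (freeM0 : Z_free_generator M0)
  (M0' : {vspace M}) (freeM0' : Z_free_generator M0')
  (P : series M) (potentialP : potential P)
  (L : 'I_n -> seq (prodalg E_))
  (basisL : forall i, basis_of (eE E_ i) (L i))
  (A : 'I_n -> 'I_n -> seq M)
  (basisA : forall i j, basis_of (eM0e M0 i j) (A i j))
  (L' : 'I_n -> seq (prodalg E_))
  (basisL' : forall i, basis_of (eE E_ i) (L' i))
  (A' : 'I_n -> 'I_n -> seq M)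
  (basisA' : forall i j, basis_of (eM0e M0' i j) (A' i j))
  (Delta : tensalg M -> TZT M) (DeltaP : is_Delta M0 Delta)
  (Delta' : tensalg M -> TZT M) (Delta'P : is_Delta M0' Delta')
  (dual : prodalg E_ -> M -> (M -> prodalg E_)) (dualP : is_dual L A dual)
  (dual' : prodalg E_ -> M -> (M -> prodalg E_)) (dual'P : is_dual L' A' dual') :
  jacobian_ideal Delta' L' A' dual' P = jacobian_ideal Delta L A dual P.
Proof.
have H : dual_bases M0 L A dual by split.
have H' : dual_bases M0' L' A' dual' by split.
apply/seteqP; split.
  exact: (jacobian_idealS H DeltaP H' Delta'P).
exact: (jacobian_idealS H' Delta'P H DeltaP).
Qed.
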